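(* Let $\mathbb{K}$ be a field of characteristic zero, let $(L,[\cdot,\cdot],\alpha)$ be a multiplicative Hom-Leibniz algebra over $\mathbb{K}$, and let $(m_t,\alpha_t)$, $m_t=\sum_{i\ge 0}m_it^i$, $\alpha_t=\sum_{i\ge 0}\alpha_it^i$, be a one-parameter formal deformation of it. Then the infinitesimal $(m_1,\alpha_1)\in\widetilde{CL}^2(L,L)$ of the deformation is a $2$-cocycle of the $\alpha$-type Hom-Leibniz cohomology, i.e. $\partial(m_1,\alpha_1)=0$.
   Context: A Hom-Leibniz algebra over $\mathbb{K}$ is a $\mathbb{K}$-vector space $L$ with a $\mathbb{K}$-bilinear map $[\cdot,\cdot]:L\times L\to L$ and a $\mathbb{K}$-linear map $\alpha:L\to L$ such that $[\alpha(x),[y,z]]=[[x,y],\alpha(z)]-[[x,z],\alpha(y)]$ for all $x,y,z\in L$. It is multiplicative if $\alpha([x,y])=[\alpha(x),\alpha(y)]$. A one-parameter formal deformation of $(L,[\cdot,\cdot],\alpha)$ is a pair of a $\mathbb{K}[[t]]$-bilinear map $m_t:L[[t]]\times L[[t]]\to L[[t]]$ and a $\mathbb{K}[[t]]$-linear map $\alpha_t:L[[t]]\to L[[t]]$ of the form $m_t=\sum_{i\ge0}m_it^i$, $\alpha_t=\sum_{i\ge0}\alpha_it^i$, where the $m_i:L\times L\to L$ are $\mathbb{K}$-bilinear, the $\alpha_i:L\to L$ are $\mathbb{K}$-linear, $m_0=[\cdot,\cdot]$, $\alpha_0=\alpha$, and for all $x,y,z$: $m_t(\alpha_t(x),m_t(y,z))=m_t(m_t(x,y),\alpha_t(z))-m_t(m_t(x,z),\alpha_t(y))$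 and $m_t(\alpha_t(x),\alpha_t(y))=\alpha_t(m_t(x,y))$. Its infinitesimal is the pair $(m_1,\alpha_1)$. $\alpha$-type complex in degrees 2 and 3: $\widetilde{CL}^2(L,L)=\mathrm{Hom}_{\mathbb{K}}(L^{\otimes2},L)\oplus\mathrm{Hom}_{\mathbb{K}}(L,L)$, $\widetilde{CL}^3(L,L)=\mathrm{Hom}_{\mathbb{K}}(L^{\otimes3},L)\oplus\mathrm{Hom}_{\mathbb{K}}(L^{\otimes2},L)$, and for $(\phi,\psi)\in\widetilde{CL}^2(L,L)$, $\partial(\phi,\psi)=(\partial_{\gamma\gamma}\phi-\partial_{\alpha\gamma}\psi,\ \partial_{\gamma\alpha}\phi-\partial_{\alpha\alpha}\psi)$ with $(\partial_{\gamma\gamma}\phi)(x,y,z)=[\alpha(x),\phi(y,z)]+[\phi(x,z),\alpha(y)]-[\phi(x,y),\alpha(z)]-\phi([x,y],\alpha(z))+\phi([x,z],\alpha(y))+\phi(\alpha(x),[y,z])$, $(\partial_{\alpha\gamma}\psi)(x,y,z)=[[x,y],\psi(z)]-[[x,z],\psi(y)]-[\psi(x),[y,z]]$, $(\partial_{\gamma\alpha}\phi)(x,y)=\alpha(\phi(x,y))-\phi(\alpha(x),\alpha(y))$, $(\partial_{\alpha\alpha}\psi)(x,y)=[\alpha(x),\psi(y)]+[\psi(x),\alpha(y)]-\psi([x,y])$. *)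

(* Defs.v *)
From HB Require Import structures.
From mathcomp Require Import all_boot all_algebra.
From mathcomp Require Import boolp functions.

Set Implicit Arguments.
Unset Strict Implicit.
Unset Printing Implicit Defensive.

Import GRing.Theory.
Local Open Scope ring_scope.

(* V[[t]]: the series \sum_n v_n t^n is the sequence v of its coefficients. An
   alias of nat -> V, because K[[t]] carries the Cauchy product and not the
   pointwise one. *)
Definition fps (V : Type) : Type := nat -> V.

HB.instance Definition _ (V : zmodType) := GRing.Zmodule.copy (fps V) (nat -> V).

Definition fpsC (V : zmodType) (v : V) : fps V := fun n => if n is 0 then v else 0.

Lemma fpsP (V : Type) (f g : fps V) : (forall n, f n = g n) <-> f = g.
Proof. by split=> [|->//] fg; apply/funext. Qed.

Lemma fpsD (V : zmodType) (f g : fps V) n : (f + g) n = f n + g n.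
Proof. by []. Qed.

Lemma triangular_exchange (V : zmodType) n (F : nat -> nat -> nat -> V) :
  \sum_(i < n.+1) \sum_(j < i.+1) F j (i - j)%N (n - i)%N =
  \sum_(j < n.+1) \sum_(k < (n - j).+1) F j k (n - j - k)%N.
Proof.
elim: n F => [|n IHn] F; first by rewrite !big_ord1.
under eq_bigr do rewrite big_ord_recl.
rewrite [RHS]big_ord_recl big_split /=; congr (_ + _).
  by apply: eq_bigr => i _; rewrite !subn0.
rewrite big_ord_recl big_ord0 add0r.
exact: (IHn (fun j k l => F j.+1 k l)).
Qed.

Section PowerSeries.
Variables (K : comNzRingType) (V : lmodType K).
Implicit Types (f g : fps K) (v w : fps V).

Definition fps1 : fps K := fpsC 1.

Definition fps_mul f g : fps K := fun n => \sum_(i < n.+1) f i * g (n - i)%N.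

Definition fps_scale f v : fps V := fun n => \sum_(i < n.+1) f i *: v (n - i)%N.

Lemma fps_mulA : associative fps_mul.
Proof.
move=> f g h; apply/fpsP => n; rewrite /fps_mul.
under [RHS]eq_bigr do rewrite mulr_suml.
rewrite (triangular_exchange n (fun i j k => f i * g j * h k)).
by apply: eq_bigr => i _; rewrite mulr_sumr; apply: eq_bigr => j _; rewrite mulrA.
Qed.

Lemma fps_mulC : commutative fps_mul.
Proof.
move=> f g; apply/fpsP => n; rewrite /fps_mul (reindex_inj rev_ord_inj) /=.
apply: eq_bigr => i _; rewrite subSS subKn ?(leq_ord i)// mulrC //.
Qed.

Lemma fps_mul1 : left_id fps1 fps_mul.
Proof.
move=> f; apply/fpsP => n; rewrite /fps_mul big_ord_recl mul1r subn0.
by rewrite big1 ?addr0// => i _; rewrite mul0r.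
Qed.

Lemma fps_mulDl : left_distributive fps_mul +%R.
Proof.
move=> f g h; apply/fpsP => n; rewrite fpsD /fps_mul -big_split /=.
by apply: eq_bigr => i _; rewrite fpsD mulrDl.
Qed.

Lemma fps1_neq0 : fps1 != 0.
Proof. by apply/eqP => /fpsP /(_ 0)/eqP; rewrite (oner_eq0 K). Qed.

Lemma fps_scaleA f g v : fps_scale f (fps_scale g v) = fps_scale (fps_mul f g) v.
Proof.
apply/fpsP => n; rewrite /fps_scale /fps_mul.
under [RHS]eq_bigr do rewrite scaler_suml.
rewrite (triangular_exchange n (fun i j k => (f i * g j) *: v k)).
by apply: eq_bigr => i _; rewrite scaler_sumr; apply: eq_bigr => j _; rewrite scalerA.
Qed.

Lemma fps_scale1 : left_id fps1 fps_scale.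
Proof.
move=> v; apply/fpsP => n; rewrite /fps_scale big_ord_recl scale1r subn0.
by rewrite big1 ?addr0// => i _; rewrite scale0r.
Qed.

Lemma fps_scaleDr : right_distributive fps_scale +%R.
Proof.
move=> f v w; apply/fpsP => n; rewrite fpsD /fps_scale -big_split /=.
by apply: eq_bigr => i _; rewrite fpsD scalerDr.
Qed.

Lemma fps_scaleDl v : {morph fps_scale^~ v : f g / f + g}.
Proof.
move=> f g; apply/fpsP => n; rewrite fpsD /fps_scale -big_split /=.
by apply: eq_bigr => i _; rewrite fpsD scalerDl.
Qed.

End PowerSeries.

HB.instance Definition _ (K : comNzRingType) :=
  GRing.Zmodule_isComNzRing.Build (fps K)
    (@fps_mulA K) (@fps_mulC K) (@fps_mul1 K) (@fps_mulDl K) (@fps1_neq0 K).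

HB.instance Definition _ (K : comNzRingType) (V : lmodType K) :=
  GRing.Zmodule_isLmodule.Build (fps K) (fps V)
    (@fps_scaleA K V) (@fps_scale1 K V) (@fps_scaleDr K V) (@fps_scaleDl K V).

Definition hom_leibniz (V : zmodType) (mu : V -> V -> V) (alpha : V -> V) :=
  forall x y z, mu (alpha x) (mu y z) =
    mu (mu x y) (alpha z) - mu (mu x z) (alpha y).

Definition hom_multiplicative (V : zmodType) (mu : V -> V -> V) (alpha : V -> V) :=
  forall x y, alpha (mu x y) = mu (alpha x) (alpha y).

Record homLeibnizAlg (R : comNzRingType) (V : lmodType R) := HomLeibnizAlg {
  bracket : {bilinear V -> V -> V};
  twist : {linear V -> V};
  bracket_hom_leibniz : hom_leibniz bracket twist }.

(* Linearity of mt and alphat is over K[[t]], so the values on L, given by mtE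
   and alphatE, determine both maps on L[[t]]: see mt_coef and alphat_coef. *)
Record deformation (K : comNzRingType) (L : lmodType K) (A : homLeibnizAlg L) :=
  Deformation {
    mt : {bilinear fps L -> fps L -> fps L};
    alphat : {linear fps L -> fps L};
    mcoef : nat -> {bilinear L -> L -> L};
    acoef : nat -> {linear L -> L};
    mtE : forall x y : L, mt (fpsC x) (fpsC y) = (fun i => mcoef i x y);
    alphatE : forall x : L, alphat (fpsC x) = (fun i => acoef i x);
    mcoef0 : forall x y : L, mcoef 0 x y = bracket A x y;
    acoef0 : forall x : L, acoef 0 x = twist A x;
    mt_hom_leibniz : hom_leibniz mt alphat;
    mt_multiplicative : hom_multiplicative mt alphat }.

Definition fpsX (K : nzRingType) : fps K := fun n => (n == 1)%:R.

Lemma fpsX_scale (K : comNzRingType) (V : lmodType K) (v : fps V) n :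
  (fpsX K *: v) n = if n is m.+1 then v m else 0.
Proof.
rewrite /GRing.scale /= /fps_scale big_ord_recl scale0r add0r.
case: n => [|n]; first by rewrite big_ord0.
rewrite big_ord_recl scale1r subSS subn0 big1 ?addr0// => i _.
by rewrite scale0r.
Qed.

Lemma fps_split (K : comNzRingType) (V : lmodType K) (v : fps V) :
  v = fpsX K *: ((fun n => v n.+1) : fps V) + fpsC (v 0).
Proof.
apply/fpsP => -[|n]; rewrite fpsD fpsX_scale; first by rewrite add0r.
by rewrite addr0.
Qed.

Section DeformationCoefficients.
Variables (K : comNzRingType) (L : lmodType K) (A : homLeibnizAlg L).
Variable D : deformation A.

Lemma alphat_coef (X : fps L) n :
  alphat D X n = \sum_(j < n.+1) acoef D (n - j) (X j).
Proof.
elim: n X => [|n IHn] X; rewrite {1}[X](fps_split (K := K)) linearP alphatE.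
  by rewrite fpsD fpsX_scale add0r big_ord1.
by rewrite fpsD fpsX_scale IHn [RHS]big_ord_recl subn0 addrC.
Qed.

Lemma mt_coefC (x : L) (Y : fps L) n :
  mt D (fpsC x) Y n = \sum_(k < n.+1) mcoef D (n - k) x (Y k).
Proof.
elim: n Y => [|n IHn] Y; rewrite {1}[Y](fps_split (K := K)) linearPr mtE.
  by rewrite fpsD fpsX_scale add0r big_ord1.
by rewrite fpsD fpsX_scale IHn [RHS]big_ord_recl subn0 addrC.
Qed.

Lemma mt_coef (X Y : fps L) n :
  mt D X Y n =
  \sum_(j < n.+1) \sum_(k < (n - j).+1) mcoef D (n - j - k) (X j) (Y k).
Proof.
elim: n X => [|n IHn] X; rewrite {1}[X](fps_split (K := K)) linearPl.
  by rewrite fpsD fpsX_scale add0r mt_coefC !big_ord1.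
by rewrite fpsD fpsX_scale IHn mt_coefC [RHS]big_ord_recl subn0 addrC.
Qed.

End DeformationCoefficients.

Section Cohomology.
Variables (K : comNzRingType) (L : lmodType K) (A : homLeibnizAlg L).

Local Notation "[ x , y ]" := (bracket A x y).
Local Notation alpha := (twist A).

(* Hom(L^{\otimes 2}, L) is the space of bilinear maps. *)
Definition CL2 : Type := ({bilinear L -> L -> L} * {linear L -> L})%type.

Definition d_gg (phi : L -> L -> L) : L -> L -> L -> L := fun x y z =>
  [alpha x, phi y z] + [phi x z, alpha y] - [phi x y, alpha z]
  - phi [x, y] (alpha z) + phi [x, z] (alpha y) + phi (alpha x) [y, z].

Definition d_ag (psi : L -> L) : L -> L -> L -> L := fun x y z =>
  [[x, y], psi z] - [[x, z], psi y] - [psi x, [y, z]].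

Definition d_ga (phi : L -> L -> L) : L -> L -> L := fun x y =>
  alpha (phi x y) - phi (alpha x) (alpha y).

Definition d_aa (psi : L -> L) : L -> L -> L := fun x y =>
  [alpha x, psi y] + [psi x, alpha y] - psi [x, y].

(* The values lie in CL^3, the subspace of pairs of a trilinear and a bilinear
   map: see coboundary_multilinear. *)
Definition coboundary (c : CL2) : (L -> L -> L -> L) * (L -> L -> L) :=
  (d_gg c.1 - d_ag c.2, d_ga c.1 - d_aa c.2).

Definition cocycle2 (c : CL2) : Prop := coboundary c = 0.

Definition trilinear (f : L -> L -> L -> L) : Prop :=
  [/\ forall y z, linear (fun x => f x y z),
      forall x z, linear (fun y => f x y z)
    & forall x y, linear (fun z => f x y z)].

Lemma linear_add (f g : L -> L) :
  linear f -> linear g -> linear (fun x => f x + g x).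
Proof. by move=> hf hg a u v; rewrite hf hg scalerDr addrACA. Qed.

Lemma linear_sub (f g : L -> L) :
  linear f -> linear g -> linear (fun x => f x - g x).
Proof. by move=> hf hg a u v; rewrite hf hg scalerBr opprD addrACA. Qed.

Lemma coboundary_multilinear (c : CL2) :
  trilinear (coboundary c).1 /\ bilinear_for *:%R *:%R (coboundary c).2.
Proof.
case: c => phi psi.
have lin_sub (f g : L -> L) : linear f -> linear g -> linear (f - g).
  exact: linear_sub.
split; split=> u.
- move=> v; apply: (lin_sub (fun x => d_gg phi x u v) (fun x => d_ag psi x u v));
    rewrite /d_gg /d_ag; do ?[apply: linear_add | apply: linear_sub];
    by move=> a w w' /=; rewrite ?(linearP, linearPl, linearPr).
- move=> v; apply: (lin_sub (d_gg phi u ^~ v) (d_ag psi u ^~ v));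
    rewrite /d_gg /d_ag; do ?[apply: linear_add | apply: linear_sub];
    by move=> a w w' /=; rewrite ?(linearP, linearPl, linearPr).
- move=> v; apply: (lin_sub (d_gg phi u v) (d_ag psi u v));
    rewrite /d_gg /d_ag; do ?[apply: linear_add | apply: linear_sub];
    by move=> a w w' /=; rewrite ?(linearP, linearPl, linearPr).
- apply: (lin_sub (d_ga phi ^~ u) (d_aa psi ^~ u));
    rewrite /d_ga /d_aa; do ?[apply: linear_add | apply: linear_sub];
    by move=> a w w' /=; rewrite ?(linearP, linearPl, linearPr).
- apply: (lin_sub (d_ga phi u) (d_aa psi u));
    rewrite /d_ga /d_aa; do ?[apply: linear_add | apply: linear_sub];
    by move=> a w w' /=; rewrite ?(linearP, linearPl, linearPr).
Qed.

End Cohomology.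

Definition infinitesimal (K : comNzRingType) (L : lmodType K)
  (A : homLeibnizAlg L) (D : deformation A) : CL2 L := (mcoef D 1, acoef D 1).

(* Main.v *)
Require Import Defs.
From mathcomp Require Import all_boot all_algebra.
From mathcomp Require Import boolp functions.

Set Implicit Arguments.
Unset Strict Implicit.
Unset Printing Implicit Defensive.

Import GRing.Theory.
Local Open Scope ring_scope.

(** The two components of the cocycle condition are the coefficients of t in the
    Hom-Leibniz identity and in multiplicativity of the deformation, evaluated
    at constant series. *)

(** In the coefficient of [t] of a composite of [mt] and [alphat] at constants, each term has
    exactly one operation replaced by its first-order part. Left side minus right side, these terms
    are [d_gg - d_ag] for [hom_leibniz] and [d_ga - d_aa] for [hom_multiplicative]. *)

Section FirstOrder.
Variables (K : comNzRingType) (L : lmodType K) (A : homLeibnizAlg L).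
Variable D : deformation A.

(** Degree one is carried by the operation or by one of the two arguments. *)
Lemma mt_coef1 (X Y : fps L) :
  mt D X Y 1 =
  mcoef D 1 (X 0) (Y 0) + bracket A (X 0) (Y 1) + bracket A (X 1) (Y 0).
Proof.
by rewrite mt_coef big_ord_recr big_ord1 big_ord1 big_ord_recr big_ord1 /= !mcoef0.
Qed.

Lemma alphat_coef1 (X : fps L) :
  alphat D X 1 = acoef D 1 (X 0) + twist A (X 1).
Proof. by rewrite alphat_coef big_ord_recr big_ord1 /= acoef0. Qed.

Lemma infinitesimal_hom_leibniz (x y z : L) :
  d_gg A (mcoef D 1) x y z = d_ag A (acoef D 1) x y z.
Proof.
have := congr1 (fun f : fps L => f 1)
  (mt_hom_leibniz D (fpsC x) (fpsC y) (fpsC z)).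
(* Unfolding the opposite of series exposes it as coefficientwise. *)
rewrite [RHS]fpsD /GRing.opp /= !mtE !mt_coef1 !alphatE !mcoef0 !acoef0.
move=> /eqP; rewrite -subr_eq0 => /eqP E.
apply/eqP; rewrite -subr_eq0; apply/eqP; rewrite -[RHS]E /d_gg /d_ag.
rewrite !(opprD, opprK) !addrA.
(* Both sides have the same nine signed terms, in different orders. *)
by rewrite [LHS](ACl (6*1*9*4*7*3*5*8*2)%AC).
Qed.

Lemma infinitesimal_multiplicative (x y : L) :
  d_ga A (mcoef D 1) x y = d_aa A (acoef D 1) x y.
Proof.
have := congr1 (fun f : fps L => f 1) (mt_multiplicative D (fpsC x) (fpsC y)).
rewrite alphat_coef1 mtE mt_coef1 !alphatE !mcoef0 !acoef0.
(* Solve for [twist A (mcoef D 1 x y)], the first term of [d_ga]. *)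
move=> /(canRL (addKr _)) E; rewrite /d_ga /d_aa E.
by rewrite !addrA [LHS](ACl (3*4*1*(2*5))%AC) /= subrr addr0.
Qed.

End FirstOrder.

Theorem theorem5p3 (K : fieldType) (charK : [pchar K] =i pred0)
    (L : lmodType K) (A : homLeibnizAlg L)
    (A_mult : hom_multiplicative (bracket A) (twist A))
    (D : deformation A) :
  cocycle2 A (infinitesimal D).
Proof.
have dL : d_gg A (mcoef D 1) = d_ag A (acoef D 1).
  by do 3!apply/funext => ?; exact: infinitesimal_hom_leibniz.
have dM : d_ga A (mcoef D 1) = d_aa A (acoef D 1).
  by do 2!apply/funext => ?; exact: infinitesimal_multiplicative.
by rewrite /cocycle2 /coboundary /= dL dM !subrr.
Qed.
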